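(* Let $\mathcal X$ be a topological Riesz space, and $\mathcal A\subset\mathcal X$ an acceptance set with nonempty interior. Let $S=(S_0,S_T)$ be a traded asset and assume that $\rho_{\mathcal A,S}$ does not attain the value $-\infty$. If $S_T$ is a weak topological unit, then $\rho_{\mathcal A,S}$ is finitely valued.
   Context: A topological Riesz space is a (Hausdorff) real topological vector space $\mathcal X$ equipped with a vector space ordering (with positive cone $\mathcal X_+$, a pointed convex cone) which is a lattice ordering; no compatibility between topology and lattice operations beyond this is assumed. $X\wedge Y=\inf\{X,Y\}$. An element $Z\in\mathcal X_+$ is a weak topological unit if for every $X\in\mathcal X_+$ one has $X\wedge nZ\to X$ as $n\to\infty$. An acceptance set is a nonempty proper subset $\mathcal A\subset\mathcal X$ such that $X\in\mathcal A$ and $Y\ge X$ imply $Y\in\mathcal A$. A traded asset is a pair $S=(S_0,S_T)$ with $S_0>0$ a real number and $S_T\in\mathcal X_+$ nonzero. The associated risk measure $\rho_{\mathcal A,S}:\mathcal X\to\mathbb R\cup\{\pm\infty\}$ is $$\rho_{\mathcal A,S}(X)=\inf\{m\in\mathbb R : X+\tfrac{m}{S_0}S_T\in\mathcal A\},$$ with $\inf\emptyset=\infty$. *)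

(* Defs.v *)
From HB Require Import structures.
From mathcomp Require Import all_boot all_order all_algebra.
From mathcomp Require Import all_classical all_reals all_analysis.

Set Implicit Arguments.
Unset Strict Implicit.
Unset Printing Implicit Defensive.
Import Order.TTheory GRing.Theory Num.Theory.
Import numFieldNormedType.Exports.
Local Open Scope classical_set_scope.
Local Open Scope ring_scope.

(* The base structure is [topologicalLmodType] and not [tvsType], since the
   latter requires local convexity. The only requirements relating the order
   to the rest are those making it a vector space ordering; in particular the
   lattice operations need not be continuous and the cone need not be closed.

   [Order.Lattice] is not inherited from directly: Hierarchy Builder refuses
   any structure joining it with [GRing.Zmodule] that is declared after
   [Num.RealDomain]. The fields [riesz_meet] to [riesz_joinP] are those of
   [Order.POrder_MeetJoin_isLattice], from which the lattice instance follows. *)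
HB.mixin Record isTopologicalRiesz (R : realType) M
    & TopologicalLmodule R M & Order.POrder ring_display M := {
  riesz_meet : M -> M -> M ;
  riesz_join : M -> M -> M ;
  riesz_meetP : forall x y z : M,
    (x <= riesz_meet y z) = (x <= y) && (x <= z) ;
  riesz_joinP : forall x y z : M,
    (riesz_join x y <= z) = (x <= z) && (y <= z) ;
  riesz_hausdorff : hausdorff_space M ;
  riesz_leD2r : forall z x y : M, x <= y -> x + z <= y + z ;
  riesz_leZ2l : forall (a : R) (x y : M), 0 <= a -> x <= y -> a *: x <= a *: y
}.

#[short(type="topologicalRieszType")]
HB.structure Definition TopologicalRiesz (R : realType) :=
  {M of TopologicalLmodule R M & Order.POrder ring_display M
      & isTopologicalRiesz R M}.

HB.instance Definition _ (R : realType) (M : topologicalRieszType R) :=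
  Order.POrder_MeetJoin_isLattice.Build ring_display (TopologicalRiesz.sort M)
    (@riesz_meetP R M) (@riesz_joinP R M).

Section risk_measures.
Context {R : realType} {X : topologicalRieszType R}.
Implicit Types (A : set X) (S : R * X) (x y z : X).

Definition weak_topological_unit z : Prop :=
  0 <= z /\
  forall x, 0 <= x -> (fun n : nat => Order.meet x (z *+ n)) @ \oo --> x.

Definition acceptance_set A : Prop :=
  [/\ A !=set0, A != setT & forall x y, A x -> x <= y -> A y].

Definition traded_asset S : Prop := [/\ 0 < S.1, 0 <= S.2 & S.2 != 0].

Definition risk_measure A S x : \bar R :=
  ereal_inf [set m%:E | m in [set m : R | A (x + (m / S.1) *: S.2)]].

End risk_measures.

(* Main.v *)
Require Import Defs.
From HB Require Import structures.
From mathcomp Require Import all_boot all_order all_algebra.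
From mathcomp Require Import all_classical all_reals all_analysis.
Import Order.TTheory GRing.Theory Num.Theory.
Import numFieldNormedType.Exports.
Local Open Scope classical_set_scope.
Local Open Scope ring_scope.

(* If [w] is interior to [A] and [u] is the positive part of [w - x], then
   [w - u + u /\ nZ] tends to [w], hence lies in [A] for some [n]; since it is
   at most [x + nZ], monotonicity puts [x + nZ] in [A]. *)
Lemma weak_topological_unit_absorbing (R : realType)
    (X : topologicalRieszType R) (A : set X) (z : X) :
  (forall x y, A x -> x <= y -> A y) -> A° !=set0 ->
  weak_topological_unit z -> forall x, exists n, A (x + z *+ n).
Proof.
move=> upA [w Aw] [_ zunit] x.
pose u := Order.join (w - x) 0.
have u0 : 0 <= u by exact: leUr.
have cvgw : (fun n : nat => (w - u) + Order.meet u (z *+ n)) @ \oo --> w.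
  rewrite -[X in _ --> X](subrK u w).
  (* Addition is jointly continuous at [(w - u, u)], and [zunit], applied to [u >= 0], gives the
     limit of the meets. *)
  apply: (@continuous2_cvg _ _ _ _ _ _ (fun _ => w - u)
    (fun n : nat => Order.meet u (z *+ n)) (fun a b : X => a + b)).
  - exact: (@tvs.add_continuous X (w - u, u)).
  - exact: cvg_cst.
  - exact: zunit.
(* By [Aw], [A] is a neighbourhood of [w], so the sequence lies in [A] from some rank [n] on. *)
have [n _ An] := cvgw _ Aw.
exists n; apply: upA (An n (leqnn n)) _.
have le_wu_x : w - u <= x.
  (* Add [x - u] to both sides of [w - x <= u]. *)
  have /(riesz_leD2r (x - u)) : w - x <= u by exact: leUl.
  by rewrite addrA subrK [u + _]addrC subrK.
apply: (le_trans (riesz_leD2r _ _ _ le_wu_x)).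
rewrite ![x + _]addrC; apply: riesz_leD2r; exact: leIr.
Qed.

Theorem theorem3p5 (R : realType) (X : topologicalRieszType R)
    (A : set X) (S : R * X) :
  acceptance_set A ->
  A° !=set0 ->
  traded_asset S ->
  (forall x : X, risk_measure A S x <> -oo%E) ->
  weak_topological_unit S.2 ->
  forall x : X, risk_measure A S x \is a fin_num.
Proof.
move=> [_ _ upA] A0 [S0 _ _] rhoNy Sunit x.
have [n An] := @weak_topological_unit_absorbing R X A S.2 upA A0 Sunit x.
rewrite fin_numE; apply/andP; split; first exact/eqP/rhoNy.
(* To exclude [+oo], buy [n] units of the asset: the capital [m = n%:R * S.1] gives
   [m / S.1 = n%:R], so [An] makes [m] a member of the set whose infimum is taken. *)
rewrite -ltey; apply: (@le_lt_trans _ _ (n%:R * S.1)%:E); last exact: ltry.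
apply: ereal_inf_lbound; exists (n%:R * S.1) => //=.
by rewrite mulfK ?gt_eqF// scaler_nat.
Qed.
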